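(* Let $q$ be a power of a prime $p$. Let $e$ and $k$ be nontrivial divisors of $q-1$ such that $q=ek+1$. If $$p>\left(\sqrt{14}\right)^{k/\operatorname{ord}_k(p)},$$ then $(a,b)\le 3$ for all $a,b\in\mathbb{Z}$, where $(a,b)$ denotes the cyclotomic number of order $e$ over $\mathbb{F}_q$.
   Context: A nontrivial divisor of $q-1$ is a divisor different from $1$ and $q-1$. $\operatorname{ord}_k(p)$ is the multiplicative order of $p$ modulo $k$. Fix a primitive element $g$ of the finite field $\mathbb{F}_q$. For $a\in\mathbb{Z}$ let $C_a=\{g^a,g^{a+e},\dots,g^{a+(k-1)e}\}$, so that $C_a=C_{a+e}$. The cyclotomic number $(a,b)$ of order $e$ is the number of solutions of $1+x=y$ with $x\in C_a$, $y\in C_b$; equivalently, the number of pairs of integers $(r,s)$ with $0\le r,s\le k-1$ and $1+g^{a+re}=g^{b+se}$. It depends only on $a,b$ modulo $e$. *)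

(* Defs.v *)
From HB Require Import structures.
From mathcomp Require Import all_boot all_order all_algebra.
From mathcomp Require Import all_fingroup all_solvable.

Set Implicit Arguments.
Unset Strict Implicit.
Unset Printing Implicit Defensive.

Import Order.TTheory GRing.Theory Num.Theory.

Local Open Scope ring_scope.

Definition nontrivial_divisor (d n : nat) : bool :=
  [&& (d %| n)%N, d != 1%N & d != n].

(* Meaningful for [1 < k] only, as ['Z_0] and ['Z_1] are both Z/2Z.  The value
   is 0 when [p] is not invertible modulo [k]. *)
Definition ord_mod (k p : nat) : nat :=
  if insub (p%:R : 'Z_k) is Some u then #[u : {unit 'Z_k}]%g else 0%N.

Lemma ord_modP (k p : nat) (hk : (1 < k)%N) (hkp : coprime k p) :
  (0 < ord_mod k p)%N /\
  forall n : nat, (p ^ n == 1 %[mod k])%N = (ord_mod k p %| n)%N.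
Proof.
rewrite /ord_mod; case: insubP => [u _ up|]; last by rewrite unitZpE ?hkp.
split=> [|n]; first exact: order_gt0.
rewrite order_dvdn -val_eqE FinRing.val_unitX up FinRing.val_unit1 -natrX.
rewrite -val_eqE /= val_Zp_nat //.
by rewrite -{1}[1%N](modn_small hk) modn_mod (modn_small hk).
Qed.

Definition cyclotomic_class (F : finFieldType) (g : F) (e k : nat) (a : int) :
    {set F} :=
  [set g ^ (a + r%:Z * e%:Z) | r : 'I_k].

Definition cyclotomic_number (F : finFieldType) (g : F) (e k : nat)
    (a b : int) : nat :=
  #|[set xy : F * F | [&& xy.1 \in cyclotomic_class g e k a,
                          xy.2 \in cyclotomic_class g e k b
                        & 1 + xy.1 == xy.2]]|.

(* Main.v *)
Require Import Defs.
From HB Require Import structures.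
From mathcomp Require Import all_boot all_order all_algebra all_field.
From mathcomp Require Import reals exp.
From mathcomp Require Import ring zify.
Import Order.TTheory GRing.Theory Num.Theory.
Import Pdiv.Ring Pdiv.RingMonic.

Local Open Scope ring_scope.

(** Three solutions of [1 + x = y] in the two classes, written
[x_i = A * u_i] and [y_i = B * v_i] with [u_i], [v_i] powers of the primitive
[k]-th root of unity [b = g ^+ e], give three collinear points [(u_i, v_i)].
The vanishing of the determinant with rows [(1, u_i, v_i)] is a relation
[f(b) = 0], where the integer polynomial [f] is a signed sum of six monomials.
The hypothesis on [p] makes such a short relation hold in characteristic 0 as
well ([lift_root_algC]). Over the complex numbers a line meets the torus
[|U| = |V| = 1] in three points only if it is parallel to an axis
or passes through the origin ([collinear_unit_norm]); both are impossible here,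
because the [u_i] are distinct and the line [1 + A * u = B * v] over [F] avoids the
origin. So there are in fact at most two solutions
([at_most_two_solutions]).

The lifting compares two estimates of the norm [N] of [f(z)], where [z] is a
complex primitive [k]-th root of unity. Let [M] be the integer matrix of
multiplication by [f] modulo the cyclotomic polynomial. A Vandermonde matrix
diagonalizes it over any field with a primitive [k]-th root of unity, with the
values of [f] at all such roots as eigenvalues. Over the complex numbers this
gives [N = \det M]. Over [F], [f] vanishes at the [ord_mod k p] distinct
conjugates [b ^+ (p ^ s)], so the reduction of [M] modulo [p] has corank at
least [ord_mod k p], and the Smith normal form shows that
[p ^ ord_mod k p] divides [N] ([dvdz_det_Cyclotomic]). On the other hand, if
the squares of the coefficients of [f] have sum at most [c], then Parseval's
identity and the inequality between arithmetic and geometric means give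
[N ^ 2 <= c ^ k] ([prod_norm_prim_le]). If [c ^ k < p ^ (2 * ord_mod k p)],
then [N = 0], so [f] vanishes at some complex primitive root.

The constant 14 comes from monomials that coincide: three equal monomials of
one sign and a repeated pair of the other have coefficients 3, 2 and 1, with
squares adding up to 14. The only worse case is [3 * ('X^i - 'X^j)], which
lifts because [p != 3] ([lift_trinom_lt]). *)

Set Implicit Arguments.
Unset Strict Implicit.
Unset Printing Implicit Defensive.

(** * Divisibility of determinants by prime powers *)

Lemma mxrank_diag (K : fieldType) (n : nat) (v : 'rV[K]_n) :
  \rank (diag_mx v) = #|[pred i | v 0 i != 0]|.
Proof.
have rowE i : row i (diag_mx v) = v 0 i *: delta_mx 0 i by rewrite row_diag_mx.
have -> : \rank (diag_mx v) =
          \rank (\sum_(i | v 0 i != 0) <<delta_mx 0 i : 'rV[K]_n>>)%MS.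
  apply/eqmx_rank/andP; split.
    apply/row_subP => i; rewrite rowE.
    have [->|vi] := eqVneq (v 0 i) 0; first by rewrite scale0r sub0mx.
    by rewrite scalemx_sub // (sumsmx_sup i) // genmxE.
  apply/sumsmx_subP => i vi; rewrite genmxE.
  by rewrite -(scalerK vi (delta_mx 0 i)) -rowE scalemx_sub // row_sub.
have /mxdirectP/= -> := @mxdirect_delta K _ [pred i | v 0 i != 0] n id (in2W (@inj_id _)).
by rewrite (eq_bigr (fun=> 1%N)) ?sum1_card // => i _; rewrite mxrank_gen mxrank_delta.
Qed.

(** In the Smith normal form the determinant is, up to sign, the product of the
diagonal entries, and each unit of corank modulo [p] makes one of them
divisible by [p]. *)
Lemma dvdz_det_mxrank (K : fieldType) (p n r : nat) (M : 'M[int]_n) :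
    p \in [pchar K] ->
    (\rank (map_mx intr M : 'M[K]_n) + r <= n)%N ->
  (p%:Z ^+ r %| \det M)%Z.
Proof.
move=> pK; have [L uL [R uR [d _ ->]]] := int_Smith_normal_form M.
set D := \matrix_(i, j) _.
have {D}-> : D = diag_mx (\row_j d`_j) by apply/matrixP=> i j; rewrite !mxE.
have unit_map A : A \in unitmx -> map_mx intr A \in @unitmx K n.
  by rewrite !unitmxE det_map_mx; apply: rmorph_unit.
rewrite !map_mxM map_diag_mx mxrankMfree ?row_free_unit ?unit_map //.
rewrite eqmxMfull ?row_full_unit ?unit_map // mxrank_diag => rk.
rewrite !det_mulmx det_diag dvdz_mulr ?dvdz_mull //.
set Z := [pred j : 'I_n | (p%:Z %| d`_j)%Z].
have rZ : (r <= #|Z|)%N.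
  rewrite -(leq_add2l #|[predC Z]|) [leqRHS]addnC cardC card_ord.
  apply: leq_trans rk; rewrite leq_add2r subset_leq_card //.
  apply/subsetP=> j; rewrite !inE !mxE; apply: contra.
  by rewrite (dvdz_pcharf pK).
rewrite (bigID Z) /= dvdz_mulr //.
apply: (@dvdz_trans (\prod_(j in Z) p%:Z)).
  by rewrite prodr_const dvdz_exp2l.
apply: (big_ind2 (fun a b => (a %| b)%Z)) => // [*|j]; first exact: dvdz_mul.
by rewrite mxE.
Qed.

(** * Multiplication by a polynomial modulo a monic polynomial *)

(** Row [i] lists the coordinates of ['X^i * f] in the basis
[1, 'X, .., 'X^(n-1)] of the quotient by [h], so that the matrix acts on row
vectors of coefficients. *)
Definition mulmod_mx (n : nat) (h f : {poly int}) : 'M[int]_n :=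
  \matrix_(i, j) (rmodp ('X^i * f) h)`_j.

Section MulMod.

Variables (K : fieldType) (n : nat) (h f : {poly int}) (x : 'rV[K]_n).
Hypotheses (h_monic : h \is monic) (size_h : size h = n.+1).
Hypotheses (hx0 : forall j, root (map_poly intr h) (x 0 j)) (x_inj : injective (x 0)).

Let V : 'M_n := Vandermonde n x.
Let E : 'rV_n := \row_j (map_poly intr f).[x 0 j].

Let unitV : V \in unitmx.
Proof.
rewrite unitmxE det_Vandermonde unitfE.
apply/prodf_neq0 => i _; apply/prodf_neq0 => j ij.
by rewrite subr_eq0 (inj_eq x_inj) neq_ltn ij orbT.
Qed.

(** Column [j] of the Vandermonde matrix evaluates coefficient vectors at the root
[x 0 j] of [h], and there the reduction of ['X^i * f] modulo [h] takes the
value [x ^ i * f(x)]. *)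
Lemma mulmod_mx_diag : map_mx intr (mulmod_mx n h f) *m V = V *m diag_mx E.
Proof.
apply/matrixP=> i j; rewrite mul_mx_diag !mxE.
set r := rmodp ('X^i * f) h.
have size_r : (size (map_poly intr r : {poly K}) <= n)%N.
  apply: leq_trans (size_poly _ _) _.
  by rewrite -ltnS -size_h ltn_rmodpN0 ?monic_neq0.
transitivity (map_poly intr r).[x 0 j].
  rewrite (horner_coef_wide _ size_r); apply: eq_bigr => l _.
  by rewrite !mxE coef_map.
have := congr1 (fun u => (map_poly intr u).[x 0 j]) (rdivp_eq h_monic ('X^i * f)).
rewrite -/r !(rmorphD, rmorphM) /= map_polyXn !hornerE.
by rewrite (eqP (hx0 j)) mulr0 add0r.
Qed.

Lemma det_mulmod_mx :
  (\det (mulmod_mx n h f))%:~R = \prod_j (map_poly intr f).[x 0 j].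
Proof.
have := congr1 determinant mulmod_mx_diag.
rewrite !det_mulmx det_diag det_map_mx mulrC.
have uV : \det V \is a GRing.unit by rewrite -unitmxE.
move/(mulrI uV) => ->.
by apply: eq_bigr => j _; rewrite mxE.
Qed.

Lemma mxrank_mulmod_mx :
  \rank (map_mx intr (mulmod_mx n h f) : 'M[K]_n) =
  #|[pred j | ~~ root (map_poly intr f) (x 0 j)]|.
Proof.
rewrite -(mxrankMfree _ (B := V)) ?row_free_unit // mulmod_mx_diag.
rewrite eqmxMfull ?row_full_unit // mxrank_diag.
by apply: eq_card => j; rewrite !inE mxE.
Qed.

End MulMod.

(** * Primitive roots of unity *)

(** Reducing the factorization of ['X^k - 1] into cyclotomic polynomials makes
[z] a root of ['Phi_d] for some [d] dividing [k]; then [z ^+ d = 1], which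
forces [d = k]. This works in any characteristic. *)
Lemma root_Cyclotomic (K : fieldType) (k : nat) (z : K) :
  k.-primitive_root z -> root (map_poly intr 'Phi_k) z.
Proof.
move=> prim_z; have k0 := prim_order_gt0 prim_z.
have Xn1 d : (0 < d)%N -> root (map_poly intr 'Phi_d) z -> z ^+ d = 1.
  move=> d0 rd; apply/eqP; rewrite -subr_eq0.
  have := congr1 (fun u => (map_poly intr u).[z]) (prod_Cyclotomic d0).
  rewrite rmorphB rmorph1 /= map_polyXn !hornerE => <-.
  rewrite (big_rem d) -?dvdn_divisors //= rmorphM /= hornerM.
  by rewrite (eqP rd) mul0r.
have := congr1 (fun u => (map_poly intr u).[z]) (prod_Cyclotomic k0).
rewrite rmorphB rmorph1 /= map_polyXn !hornerE (prim_expr_order prim_z) subrr.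
rewrite rmorph_prod horner_prod => /eqP; rewrite prodf_seq_eq0 => /hasP[d].
rewrite -dvdn_divisors //= => dk rd.
have d0 := dvdn_gt0 k0 dk.
suff -> : k = d by [].
apply/eqP; rewrite eqn_dvd dk andbT (prim_order_dvd prim_z).
by rewrite Xn1.
Qed.

Definition prim_exponents (k : nat) : pred 'I_k := fun j => coprime j k.
Arguments prim_exponents : clear implicits.

Lemma card_prim_exponents k : #|prim_exponents k| = totient k.
Proof.
rewrite totient_count_coprime big_mkord -sum1_card big_mkcond /=.
by apply: eq_bigr => j _; rewrite unfold_in coprime_sym; case: coprime.
Qed.

Definition prim_roots_row (K : fieldType) (k : nat) (z : K) :
    'rV[K]_#|prim_exponents k| :=
  \row_j z ^+ (enum_val j : 'I_k).

Lemma size_Phi_card k : size 'Phi_k = #|prim_exponents k|.+1.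
Proof. by rewrite size_Cyclotomic card_prim_exponents. Qed.

Section PrimRootsRow.
Variables (K : fieldType) (k : nat) (z : K).
Hypothesis prim_z : k.-primitive_root z.

Lemma prim_roots_row_prim j : k.-primitive_root (prim_roots_row k z 0 j).
Proof. by rewrite mxE prim_root_exp_coprime //; exact: enum_valP j. Qed.

Lemma prim_roots_row_inj : injective (prim_roots_row k z 0).
Proof.
move=> i j; rewrite !mxE => /eqP; rewrite (eq_prim_root_expr prim_z).
by rewrite !modn_small // => /eqP/val_inj/enum_val_inj.
Qed.

Lemma prim_roots_row_root j :
  root (map_poly intr 'Phi_k) (prim_roots_row k z 0 j).
Proof. exact/root_Cyclotomic/prim_roots_row_prim. Qed.

End PrimRootsRow.

Lemma root_expr_pchar (K : fieldType) (p s : nat) (f : {poly int}) (b : K) :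
    p \in [pchar K] ->
  root (map_poly intr f) b -> root (map_poly intr f) (b ^+ (p ^ s)).
Proof.
move=> pK rb; elim: s => [|s]; first by rewrite expn0 expr1.
rewrite expnSr exprM; set c := b ^+ _ => /eqP rc; apply/eqP.
have -> : map_poly intr f = map_poly (pFrobenius_aut pK) (map_poly intr f).
  by rewrite -map_poly_comp; apply: eq_map_poly => a /=; rewrite rmorph_int.
by rewrite -(pFrobenius_autE pK) horner_map rc rmorph0.
Qed.

Lemma modn_expn_inj (p k : nat) : (1 < k)%N -> coprime k p ->
  forall s t : 'I_(ord_mod k p), (p ^ s = p ^ t %[mod k])%N -> s = t.
Proof.
move=> k1 kp s t; have [_ ordP] := ord_modP k1 kp.
have p_gt0 : (0 < p)%N.
  rewrite lt0n; apply: contraL kp => /eqP->.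
  by rewrite /coprime gcdn0 neq_ltn k1 orbT.
wlog st : s t / (s <= t)%N => [IH|].
  by case/orP: (leq_total s t) => /IH {}IH /esym; [move/esym/IH|move/IH->].
move/eqP; rewrite eq_sym eqn_mod_dvd ?leq_pexp2l //.
rewrite -{1}(subnK st) addnC expnD -{2}[(p ^ s)%N]muln1 -mulnBr.
rewrite Gauss_dvdr ?coprimeXr // -eqn_mod_dvd ?expn_gt0 ?p_gt0 // ordP.
move=> /dvdn_leq ts.
apply/val_inj/eqP; rewrite eqn_leq st leqNgt -subn_gt0; apply/negP=> /ts.
by rewrite leqNgt (leq_ltn_trans (leq_subr _ _)) // ltn_ord.
Qed.

(** Frobenius makes [f] vanish at [b ^+ (p ^ s)] for all [s]. There are
[ord_mod k p] such roots, and each of them is a zero eigenvalue modulo [p] of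
multiplication by [f]. *)
Lemma dvdz_det_Cyclotomic (K : fieldType) (p k : nat) (f : {poly int}) (b : K) :
    p \in [pchar K] -> (1 < k)%N -> coprime k p -> k.-primitive_root b ->
    root (map_poly intr f) b ->
  (p%:Z ^+ ord_mod k p %| \det (mulmod_mx #|prim_exponents k| 'Phi_k f))%Z.
Proof.
move=> pK k1 kp prim_b rb.
apply: (dvdz_det_mxrank pK).
rewrite (mxrank_mulmod_mx _ (Cyclotomic_monic k) (size_Phi_card k)
  (prim_roots_row_root prim_b) (prim_roots_row_inj prim_b)).
set P := [pred j | ~~ _].
have mk s : (p ^ s %% k < k)%N by rewrite ltn_pmod // ltnW.
have Am s : Ordinal (mk s) \in prim_exponents k.
  by rewrite unfold_in /= coprime_modl coprimeXl // coprime_sym.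
(* The position, in the enumeration of the primitive roots, of the conjugate
   [b ^+ (p ^ s)]. *)
pose idx (s : 'I_(ord_mod k p)) := enum_rank_in (Am 0%N) (Ordinal (mk s)).
have idx_inj : injective idx.
  by move=> s t /(enum_rank_in_inj (Am s) (Am t)) []; apply: modn_expn_inj.
rewrite -[leqRHS]card_ord -(cardC P) leq_add2l.
rewrite -[X in (X <= _)%N]card_ord -(card_codom idx_inj) subset_leq_card //.
apply/subsetP=> _ /codomP[s ->]; rewrite !inE negbK mxE enum_rankK_in //=.
by rewrite (prim_expr_mod prim_b) (root_expr_pchar _ pK).
Qed.

(** * Bounding the norm *)

Lemma expnS_bernoulli N m : (m <= N)%N -> (N.+1 ^ m * (N.+1 - m) <= N ^ m * N.+1)%N.
Proof.
elim: m => [|m IH] mN; first by rewrite !expn0 subn0.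
have le : (N.+1 * (N.+1 - m.+1) <= N * (N.+1 - m))%N.
  by rewrite subSS subSn ?(ltnW mN) // mulSn mulnS leq_add2r leq_subr.
rewrite !expnS mulnAC -[leqRHS]mulnA.
apply: leq_trans (leq_mul (leqnn N) (IH (ltnW mN))).
by rewrite mulnCA mulnC leq_mul.
Qed.

(** An elementary form of [(1 + 1 / N) ^ N < e]: by Bernoulli's inequality each
half of the exponent contributes a factor at most 2. *)
Lemma expnS_le4 N n : (n <= N)%N -> (N.+1 ^ n <= 4 * N ^ n)%N.
Proof.
move=> nN.
have half m : (m.*2 <= N.+1)%N -> (N.+1 ^ m <= 2 * N ^ m)%N.
  move=> mN; have mN' : (m <= N)%N by lia.
  rewrite -(leq_pmul2r (ltn0Sn N)) -mulnA.
  apply: leq_trans (leq_mul (leqnn 2) (expnS_bernoulli mN')).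
  by rewrite mulnCA leq_mul2l; apply/orP; right; lia.
rewrite -(odd_double_half n) -addnn addnA !expnD.
have := half (odd n + n./2)%N; have := half n./2; rewrite !expnD.
move=> /(_ ltac:(lia)) H1 /(_ ltac:(lia)) H2.
by apply: leq_trans (leq_mul H2 H1) _; rewrite mulnACA.
Qed.

(** This replaces the estimate [(1 + s / n) ^ n <= e ^ s]; it pays for averaging
over all [k]-th roots of unity when only the primitive ones are wanted. *)
Lemma expnD_le4 n s : ((n + s) ^ n <= 4 ^ s * n ^ n)%N.
Proof.
elim: s => [|s IH]; first by rewrite addn0 mul1n.
rewrite addnS; apply: leq_trans (expnS_le4 (leq_addr s n)) _.
by rewrite expnS -mulnA leq_mul2l IH orbT.
Qed.

(** Parseval's identity on the cyclic group of order [k]. *)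
Lemma sum_sqr_norm (k : nat) (z : algC) (f : {poly int}) :
    k.-primitive_root z -> (size f <= k)%N ->
  \sum_(j < k) `|(map_poly intr f).[z ^+ j]| ^+ 2 =
  k%:R * (\sum_(i < k) f`_i ^+ 2)%:~R.
Proof.
move=> prim_z fk; have k0 := prim_order_gt0 prim_z.
have z0 : z != 0 by rewrite (prim_root_eq0 prim_z) -lt0n.
have zJ : z^* = z^-1.
  have: `|z| = 1.
    apply/eqP; rewrite -(@pexpr_eq1 _ _ k) -?lt0n //.
    by rewrite -normrX (prim_expr_order prim_z) normr1.
  by move=> z1; rewrite invC_norm z1 expr1n invr1 mul1r.
have orth (i l : 'I_k) : \sum_(j < k) (z ^+ i / z ^+ l) ^+ j = (k * (i == l))%:R.
  have [->|il] := eqVneq i l.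
    rewrite divff ?expf_neq0 // (eq_bigr (fun=> 1)) => [|j _]; last exact: expr1n.
    by rewrite sumr_const card_ord muln1.
  have w1 : z ^+ i / z ^+ l - 1 != 0.
    rewrite subr_eq0 -(inj_eq (mulIf (expf_neq0 l z0))) divfK ?expf_neq0 // mul1r.
    by rewrite (eq_prim_root_expr prim_z) !modn_small.
  apply: (mulfI w1); rewrite -subrX1 muln0 mulr0 exprMn exprVn.
  rewrite -!exprM ![(_ * k)%N]mulnC !exprM (prim_expr_order prim_z).
  by rewrite !expr1n divr1 subrr.
have fE (y : algC) : (map_poly intr f).[y] = \sum_(i < k) (f`_i)%:~R * y ^+ i.
  rewrite (@horner_coef_wide _ k) ?(leq_trans (size_poly _ _)) //.
  by apply: eq_bigr => i _; rewrite coef_map.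
transitivity (\sum_(j < k) \sum_(i < k) \sum_(l < k)
    (f`_i * f`_l)%:~R * (z ^+ i / z ^+ l) ^+ j).
  apply: eq_bigr => j _; rewrite normCK fE rmorph_sum big_distrlr /=.
  apply: eq_bigr => i _; apply: eq_bigr => l _.
  rewrite rmorphM /= rmorph_int !rmorphXn /= zJ intrM mulrACA; congr (_ * _).
  by rewrite exprMn !exprVn -!exprM ![(j * _)%N]mulnC.
rewrite exchange_big rmorph_sum mulr_sumr /=; apply: eq_bigr => i _.
rewrite exchange_big (bigD1 i) //= [X in _ + X]big1 ?addr0 => [|l li]; last first.
  by rewrite -mulr_sumr orth eq_sym (negPf li) muln0 mulr0.
by rewrite -mulr_sumr orth eqxx muln1 mulrC.
Qed.

(** With [n] the number of primitive roots, the means inequality and Parseval's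
identity bound the product by [(k * c / n) ^ n], and [(k / n) ^ n] is at most
[4 ^ (k - n)]. *)
Lemma prod_norm_prim_le (k c : nat) (z : algC) (f : {poly int}) :
    k.-primitive_root z -> (size f <= k)%N -> (4 <= c)%N ->
    \sum_(i < k) f`_i ^+ 2 <= c%:Z ->
  \prod_(j in prim_exponents k) `|(map_poly intr f).[z ^+ j]| ^+ 2 <= (c ^ k)%:R.
Proof.
move=> prim_z fk c4 fc; have k0 := prim_order_gt0 prim_z.
set n := #|prim_exponents k|.
have n0 : (0 < n)%N by rewrite /n card_prim_exponents totient_gt0.
have nk : (n <= k)%N by rewrite -[leqRHS]card_ord max_card.
rewrite -(ler_pM2r (_ : 0 < (n ^ n)%:R)) ?ltr0n ?expn_gt0 ?n0 //.
rewrite mulr_natr -prodrMn_const.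
apply: le_trans
  (_ : (\sum_(j in prim_exponents k) `|(map_poly intr f).[z ^+ j]| ^+ 2) ^+ n <= _).
  by rewrite leif_AGM_scaled // => j _; rewrite mulrn_wge0 ?exprn_ge0.
apply: le_trans (_ : ((k * c)%:R : algC) ^+ n <= _).
  rewrite lerXn2r ?nnegrE ?ler0n ?sumr_ge0 // => [j _|]; first exact: exprn_ge0.
  apply: le_trans (_ : \sum_(j < k) `|(map_poly intr f).[z ^+ j]| ^+ 2 <= _).
    rewrite [leRHS](bigID (fun j => j \in prim_exponents k)) /= lerDl.
    by rewrite sumr_ge0 // => j _; exact: exprn_ge0.
  rewrite sum_sqr_norm // natrM ler_pM2l ?ltr0n //.
  by rewrite -[c%:R]/(c%:Z%:~R) ler_int.
rewrite -natrX -natrM ler_nat -{1 2}(subnKC nk) expnMn.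
apply: leq_trans (leq_mul (expnD_le4 n (k - n)) (leqnn _)) _.
rewrite mulnAC leq_mul2r; apply/orP; right.
by rewrite mulnC expnD leq_mul //; case: (k - n)%N => // s; rewrite leq_exp2r.
Qed.

(** The product of the values of [f] at the complex primitive [k]-th roots of
unity is an integer divisible by [p ^ ord_mod k p], yet too small to be a
nonzero multiple of it. *)
Lemma lift_root_algC (K : fieldType) (p k c : nat) (f : {poly int}) (b : K) :
    p \in [pchar K] -> (1 < k)%N -> coprime k p -> k.-primitive_root b ->
    (size f <= k)%N -> (4 <= c)%N -> \sum_(i < k) f`_i ^+ 2 <= c%:Z ->
    (c ^ k < p ^ (2 * ord_mod k p))%N -> root (map_poly intr f) b ->
  exists2 z : algC, k.-primitive_root z & root (map_poly intr f) z.
Proof.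
move=> pK k1 kp prim_b fk c4 fc ck rb.
have [z prim_z] := C_prim_root_exists (ltnW k1).
set N := \det (mulmod_mx #|prim_exponents k| 'Phi_k f).
have defN : N%:~R = \prod_j (map_poly intr f).[prim_roots_row k z 0 j].
  apply: det_mulmod_mx (Cyclotomic_monic k) (size_Phi_card k) _ _.
  - exact: prim_roots_row_root.
  - exact: prim_roots_row_inj.
have [N0|N0] := eqVneq N 0.
  move/esym/eqP: defN; rewrite N0 => /prodf_eq0[j _ rj].
  by exists (prim_roots_row k z 0 j); first exact: prim_roots_row_prim.
have dvdN : (p%:Z ^+ ord_mod k p %| N)%Z by exact: dvdz_det_Cyclotomic rb.
move: ck; rewrite ltnNge => /negP[].
apply: leq_trans (_ : `|N| ^ 2 <= _)%N.
  rewrite mulnC expnM leq_exp2r // dvdn_leq ?absz_gt0 //.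
  by move: dvdN; rewrite dvdzE abszX.
rewrite -(ler_nat algC).
apply: le_trans (prod_norm_prim_le prim_z fk c4 fc).
rewrite prodrXl -normr_prod big_enum_val /=.
rewrite natrX natr_absz intr_norm defN.
by under eq_bigr do rewrite mxE.
Qed.

(** * Relations between six roots of unity *)

Lemma ord_mod_leq (p k : nat) : (1 < k)%N -> coprime k p -> (ord_mod k p <= k)%N.
Proof.
move=> k1 kp; have mk s : (p ^ s %% k < k)%N by rewrite ltn_pmod // ltnW.
rewrite -[leqLHS]card_ord -[leqRHS]card_ord.
apply: (@leq_card _ _ (fun s : 'I_(ord_mod k p) => Ordinal (mk s))) => s t [].
exact: modn_expn_inj.
Qed.

Definition trinom (a1 a2 a3 : nat) : {poly int} := 'X^a1 + 'X^a2 + 'X^a3.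

Lemma size_trinom k a1 a2 a3 :
  (a1 < k)%N -> (a2 < k)%N -> (a3 < k)%N -> (size (trinom a1 a2 a3) <= k)%N.
Proof.
move=> *; rewrite /trinom !(leq_trans (size_polyD _ _)) // geq_max.
by rewrite (leq_trans (size_polyD _ _)) // ?geq_max !size_polyXn //; apply/andP.
Qed.

(** The sum counts the ordered pairs of equal exponents. *)
Lemma trinom_sqr k a1 a2 a3 : (a1 < k)%N -> (a2 < k)%N -> (a3 < k)%N ->
  \sum_(i < k) (trinom a1 a2 a3)`_i ^+ 2 =
  (3 + 2 * ((a1 == a2) + (a1 == a3) + (a2 == a3)))%N%:Z.
Proof.
move=> k1 k2 k3.
have ind a c : (a < k)%N ->
    \sum_(i < k) ((i : nat) == a)%:R * ((i : nat) == c)%:R = (a == c)%:Z.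
  move=> ak; rewrite (bigD1 (Ordinal ak)) //= eqxx mul1r big1 ?addr0 => [|i ia].
    by case: eqP.
  by rewrite -[(i : nat) == a]/(i == Ordinal ak) (negPf ia) mul0r.
pose ind' a c := \sum_(i < k) ((i : nat) == a)%:R * ((i : nat) == c)%:R : int.
transitivity (ind' a1 a1 + ind' a2 a2 + ind' a3 a3
    + 2 * (ind' a1 a2 + ind' a1 a3 + ind' a2 a3)).
  rewrite /ind' -!big_split mulr_sumr -big_split /=; apply: eq_bigr => i _.
  by rewrite !coefE; ring.
by rewrite /ind' !ind // !eqxx; lia.
Qed.

Lemma map_trinom (R : comNzRingType) (x : R) a1 a2 a3 :
  (map_poly intr (trinom a1 a2 a3)).[x] = x ^+ a1 + x ^+ a2 + x ^+ a3.
Proof. by rewrite /trinom !rmorphD /= !map_polyXn !hornerE. Qed.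

(** If the exponents in one trinomial are not all equal, its coefficients have
squares adding up to at most 5, against 9 otherwise. Cancellation between the
trinomials can only help, so the total is at most 14 unless both are of the
form [3 * 'X^i]; in that case dividing by 3 leaves an equality between two
powers of [b]. *)
Lemma lift_trinom_lt (K : fieldType) (p k : nat) (b : K)
    (a1 a2 a3 c1 c2 c3 : nat) :
    p \in [pchar K] -> (1 < k)%N -> coprime k p -> k.-primitive_root b ->
    (14 ^ k < p ^ (2 * ord_mod k p))%N ->
    [&& a1 < k, a2 < k & a3 < k]%N -> [&& c1 < k, c2 < k & c3 < k]%N ->
    root (map_poly intr (trinom a1 a2 a3 - trinom c1 c2 c3)) b ->
  exists2 z : algC, k.-primitive_root z &
    root (map_poly intr (trinom a1 a2 a3 - trinom c1 c2 c3)) z.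
Proof.
move=> pK k1 kp prim_b ck /and3P[a1k a2k a3k] /and3P[c1k c2k c3k] rb.
have [/and4P[/eqP a12 /eqP a13 /eqP c12 /eqP c13]|neq] :=
    boolP [&& a1 == a2, a1 == a3, c1 == c2 & c1 == c3].
  (* For [p = 3] the bound on [p] fails, since [ord_mod k 3 <= k] and
     [3 ^ 2 < 14]. *)
  have p3 : 3%:R != 0 :> K.
    rewrite -(dvdn_pcharf pK) dvdn_prime2 ?(pcharf_prime pK) //.
    apply: contraTneq ck => p3; rewrite -leqNgt expnM.
    apply: leq_trans (_ : 9 ^ k <= _)%N; last by rewrite leq_exp2r // ltnW.
    by rewrite {1}p3 leq_pexp2l // ord_mod_leq.
  move: rb; rewrite /root -a12 -a13 -c12 -c13.
  rewrite rmorphB hornerD hornerN !map_trinom subr_eq0.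
  have tri (x : K) : x + x + x = 3%:R * x by ring.
  rewrite !tri (inj_eq (mulfI p3)) (eq_prim_root_expr prim_b) !modn_small //.
  move=> /eqP->; rewrite subrr map_poly0.
  have [z prim_z] := C_prim_root_exists (ltnW k1).
  by exists z; rewrite // horner0.
have size_f : (size (trinom a1 a2 a3 - trinom c1 c2 c3)%R <= k)%N.
  by rewrite (leq_trans (size_polyD _ _)) // size_polyN geq_max !size_trinom.
apply: (lift_root_algC pK k1 kp prim_b size_f _ _ ck rb) => //.
have coef0 d1 d2 d3 i : (0 : int) <= (trinom d1 d2 d3)`_i.
  by rewrite !coefE !addr_ge0 // ler0n.
apply: (@le_trans _ _ (\sum_(i < k) (trinom a1 a2 a3)`_i ^+ 2
                       + \sum_(i < k) (trinom c1 c2 c3)`_i ^+ 2)).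
  rewrite -big_split; apply: ler_sum => i _ /=.
  rewrite coefB sqrrB addrAC lerBlDr lerDl.
  by rewrite mulrn_wge0 // mulr_ge0.
rewrite !trinom_sqr // -PoszD lez_nat.
(* The number of pairs among three exponents cannot be 2. *)
have pairs (x1 x2 x3 : nat) : ((x1 == x2) + (x1 == x3) + (x2 == x3)
    <= if (x1 == x2) && (x1 == x3) then 3 else 1)%N.
  case: (x1 =P x2) => [->|x12]; first by case: eqP.
  by case: (x1 =P x3) => [<-|_]; [case: eqP x12 => // -> | case: eqP].
have := pairs a1 a2 a3; have := pairs c1 c2 c3; move: neq.
by case: (a1 == a2); case: (a1 == a3); case: (c1 == c2); case: (c1 == c3) => /=; lia.
Qed.

Lemma lift_trinom_algC (K : fieldType) (p k : nat) (b : K)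
    (a1 a2 a3 c1 c2 c3 : nat) :
    p \in [pchar K] -> (1 < k)%N -> coprime k p -> k.-primitive_root b ->
    (14 ^ k < p ^ (2 * ord_mod k p))%N ->
    b ^+ a1 + b ^+ a2 + b ^+ a3 = b ^+ c1 + b ^+ c2 + b ^+ c3 ->
  exists2 z : algC, k.-primitive_root z &
    z ^+ a1 + z ^+ a2 + z ^+ a3 = z ^+ c1 + z ^+ c2 + z ^+ c3.
Proof.
move=> pK k1 kp prim_b ck.
have rootE (L : fieldType) (x : L) : k.-primitive_root x ->
    root (map_poly intr (trinom (a1 %% k) (a2 %% k) (a3 %% k)
                         - trinom (c1 %% k) (c2 %% k) (c3 %% k))) x =
    (x ^+ a1 + x ^+ a2 + x ^+ a3 == x ^+ c1 + x ^+ c2 + x ^+ c3).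
  move=> prim_x; rewrite /root rmorphB hornerD hornerN !map_trinom subr_eq0.
  by rewrite !(prim_expr_mod prim_x).
move/eqP; rewrite -rootE // => rb.
have [||z prim_z rz] := lift_trinom_lt pK k1 kp prim_b ck _ _ rb.
- by rewrite !ltn_pmod // ltnW.
- by rewrite !ltn_pmod // ltnW.
by exists z => //; apply/eqP; rewrite -rootE.
Qed.

(** Collinearity reads [(U2 - U1) * (V3 - V1) = (U3 - U1) * (V2 - V1)]. On the unit
circle conjugation is inversion, which turns [U2 - U1] into
[- (U2 - U1) / (U1 * U2)] and likewise for the others; the conjugate relation is
thus the original one with an extra factor on each side, and comparing the two
gives the conclusion. *)
Lemma collinear_unit_norm (C : numClosedFieldType) (U1 U2 U3 V1 V2 V3 : C) :
    `|U1| = 1 -> `|U2| = 1 -> `|U3| = 1 -> `|V1| = 1 -> `|V2| = 1 -> `|V3| = 1 ->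
    U1 != U2 -> V1 != V3 -> 
    U1 * V2 + U2 * V3 + U3 * V1 = U2 * V1 + U3 * V2 + U1 * V3 ->
  U3 * V2 = U2 * V3.
Proof.
move=> u1 u2 u3 v1 v2 v3 u12 v13 e.
have J (x : C) : `|x| = 1 -> x^* = x^-1.
  by move=> x1; rewrite invC_norm x1 expr1n invr1 mul1r.
have nz (x : C) : `|x| = 1 -> x != 0 by move=> x1; rewrite -normr_eq0 x1 oner_eq0.
have := congr1 Num.conj e; rewrite !(rmorphD, rmorphM) /= !J // => ec.
have e1 : (U2 - U1) * (V3 - V1) = (U3 - U1) * (V2 - V1).
  apply/subr0_eq; transitivity (U1 * V2 + U2 * V3 + U3 * V1
    - (U2 * V1 + U3 * V2 + U1 * V3)); first by ring.
  by rewrite e subrr.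
have e2 : (U2 - U1) * (V3 - V1) * (U3 * V2) = (U3 - U1) * (V2 - V1) * (U2 * V3).
  apply/subr0_eq; transitivity (U1 * U2 * U3 * V1 * V2 * V3
    * ((U1^-1 * V2^-1 + U2^-1 * V3^-1 + U3^-1 * V1^-1)
       - (U2^-1 * V1^-1 + U3^-1 * V2^-1 + U1^-1 * V3^-1))).
    by field; rewrite !nz.
  by rewrite ec subrr mulr0.
move: e2; rewrite -e1; apply: mulfI.
by rewrite mulf_neq0 // subr_eq0 eq_sym.
Qed.

(** * Cyclotomic numbers *)

(** The lifted points satisfy [U3 * V2 = U2 * V3], a relation between roots of
unity that descends to [K]: the second and third points lie on a line through
the origin. The line [1 + A * u = B * v] meets such a line only once. *)
Lemma at_most_two_solutions (K : fieldType) (p k : nat) (b A B : K)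
    (r1 r2 r3 s1 s2 s3 : nat) :
    p \in [pchar K] -> (1 < k)%N -> coprime k p -> k.-primitive_root b ->
    (14 ^ k < p ^ (2 * ord_mod k p))%N -> A != 0 -> B != 0 ->
    1 + A * b ^+ r1 = B * b ^+ s1 -> 1 + A * b ^+ r2 = B * b ^+ s2 ->
    1 + A * b ^+ r3 = B * b ^+ s3 ->
  b ^+ r1 != b ^+ r2 -> b ^+ r1 != b ^+ r3 -> b ^+ r2 = b ^+ r3.
Proof.
move=> pK k1 kp prim_b ck A0 B0 E1 E2 E3 r12 r13.
have det0 : b ^+ (r1 + s2) + b ^+ (r2 + s3) + b ^+ (r3 + s1) =
            b ^+ (r2 + s1) + b ^+ (r3 + s2) + b ^+ (r1 + s3).
  apply: (mulfI B0); rewrite !exprD !mulrDr.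
  rewrite ![B * (_ * _)]mulrCA -E1 -E2 -E3; ring.
have [z prim_z] := lift_trinom_algC pK k1 kp prim_b ck det0.
have norm_z n : `|z ^+ n| = 1.
  apply/eqP; rewrite -(@pexpr_eq1 _ _ k) -?lt0n ?normr_ge0 ?(ltnW k1) //.
  by rewrite -normrX exprAC (prim_expr_order prim_z) expr1n normr1.
have expE i j : (z ^+ i == z ^+ j) = (b ^+ i == b ^+ j).
  by rewrite (eq_prim_root_expr prim_z) (eq_prim_root_expr prim_b).
have s13 : b ^+ s1 != b ^+ s3.
  apply: contraNneq r13 => e; apply/eqP/(mulfI A0)/(addrI 1).
  by rewrite E1 E3 e.
rewrite !exprD => /collinear_unit_norm; rewrite !norm_z !expE.
move=> /(_ erefl erefl erefl erefl erefl erefl r12 s13)/eqP.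
rewrite -!exprD expE !exprD => /eqP e.
have : b ^+ r3 * (B * b ^+ s2) = b ^+ r2 * (B * b ^+ s3).
  by rewrite !(mulrCA _ B) e.
rewrite -E2 -E3 !mulrDr !mulr1 => e'.
apply/esym/(addIr (A * b ^+ r2 * b ^+ r3)); move: e'.
by rewrite mulrC -mulrA [b ^+ r2 * (A * _)]mulrCA mulrA => ->.
Qed.

Unset Implicit Arguments.

Theorem theorem1 (R : realType) (p m q e k : nat) (hp : prime p)
  (hm : (0 < m)%N) (hq : q = (p ^ m)%N)
  (F : finFieldType) (hF : #|F| = q)
  (g : F) (hg : q.-1.-primitive_root g)
  (he : nontrivial_divisor e q.-1) (hk : nontrivial_divisor k q.-1)
  (hek : q = (e * k + 1)%N)
  (hpk : Num.sqrt (14 : R) `^ (k%:R / (ord_mod k p)%:R) < p%:R) :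
  forall a b : int, (cyclotomic_number g e k a b <= 3)%N.
Proof.
move=> a b.
have pF : p \in [pchar F] by apply: card_finPcharP hp; rewrite hF hq.
have q1 : q.-1 = (e * k)%N by rewrite hek addn1.
have q1_gt0 : (0 < e * k)%N by rewrite -q1 (prim_order_gt0 hg).
have k1 : (1 < k)%N.
  have /and3P[_ kn1 _] := hk; rewrite ltn_neqAle eq_sym kn1.
  by move: q1_gt0; rewrite muln_gt0 => /andP[].
have kp : coprime k p.
  rewrite coprime_sym prime_coprime //; apply/negP => pk.
  have: (p %| q)%N by rewrite hq dvdn_exp.
  by rewrite hek dvdn_addr ?dvdn_mull // dvdn1 => /eqP p1; rewrite p1 in hp.
have prim_b : k.-primitive_root (g ^+ e).
  have := dvdn_prim_root hg (_ : k %| q.-1)%N; rewrite q1 mulnK ?(ltnW k1) //.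
  by apply; rewrite dvdn_mull.
have g0 : g != 0 by rewrite (prim_root_eq0 hg) -lt0n (prim_order_gt0 hg).
(* The bound on [p] is raised to the power [2 * ord_mod k p]. *)
have ck : (14 ^ k < p ^ (2 * ord_mod k p))%N.
  have [d0 _] := ord_modP k1 kp.
  have sq0 : 0 <= Num.sqrt (14 : R) by exact: sqrtr_ge0.
  rewrite -(ltr_nat R) !natrX mulnC exprM.
  have -> : (14%:R : R) ^+ k =
      (Num.sqrt 14 `^ (k%:R / (ord_mod k p)%:R)) ^+ ord_mod k p ^+ 2.
    rewrite -[_ ^+ ord_mod k p]powR_mulrn ?powR_ge0 // -powRrM.
    rewrite divfK ?pnatr_eq0 -?lt0n // powR_mulrn // exprAC sqr_sqrtr //.
  rewrite ltrXn2r ?exprn_ge0 ?powR_ge0 ?ler0n //.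
  by rewrite ltrXn2r ?powR_ge0 ?ler0n // -lt0n.
rewrite leqNgt; apply/negP => /ltnW/card_gt2P[[x1 y1] [[x2 y2] [[x3 y3]]]].
move=> [[]]; rewrite !inE /=.
have class_g c x : x \in cyclotomic_class g e k c ->
    exists r : nat, x = g ^ c * (g ^+ e) ^+ r.
  case/imsetP=> r _ ->; exists r.
  by rewrite expfzDr // -PoszM -exprnP mulnC exprM.
move=> /and3P[/class_g[r1 ->] /class_g[s1 ->] /eqP E1].
move=> /and3P[/class_g[r2 ->] /class_g[s2 ->] /eqP E2].
move=> /and3P[/class_g[r3 ->] /class_g[s3 ->] /eqP E3].
rewrite -E1 -E2 -E3.
case=> n12 n23 n31.
have neq r r' : (g ^ a * (g ^+ e) ^+ r, 1 + g ^ a * (g ^+ e) ^+ r)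
   != (g ^ a * (g ^+ e) ^+ r', 1 + g ^ a * (g ^+ e) ^+ r') ->
   (g ^+ e) ^+ r != (g ^+ e) ^+ r'.
  by apply: contra => /eqP ->.
move: n31; rewrite eq_sym => n13.
have r23 := at_most_two_solutions pF k1 kp prim_b ck (expfz_neq0 a g0)
  (expfz_neq0 b g0) E1 E2 E3 (neq _ _ n12) (neq _ _ n13).
by move: (neq _ _ n23); rewrite r23 eqxx.
Qed.
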